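(* Let $M\ge 1$ be an integer, $\theta=\tfrac{2\pi}{M}$, and $\omega_M=\exp(i\theta)$. Let $$\tau_{AB}=\frac1M\sum_{k=0}^{M-1}\sum_{l=0}^{M-1}|k\rangle\langle l|_A\otimes\tau_{kl}$$ be an arbitrary bipartite matrix on $\mathbb C^M\otimes\mathcal H_B$, where the $\tau_{kl}$ are operators on $\mathcal H_B$. Assume that $$U_\theta\,\tau_{kl}\,U_\theta^\dagger=\tau_{k+1,l+1}\quad\text{for all }k,l\in\{0,\dots,M-1\},$$ with indices taken mod $M$. Then $\tau_{AB}$ is unitarily equivalent to the block diagonal matrix $$\mathcal D(\tau_{AB})=\bigoplus_{k=0}^{M-1}E_k,\qquad E_k=\frac1M\sum_{l=0}^{M-1}\omega_M^{k l}\,\tau_{0l}\,U_\theta^{\,l}.$$ Moreover, $$\sum_{k=0}^{M-1}E_k=\tau_{00},$$ and $\tau_{AB}$ is positive semidefinite if and only if all of the $E_k$, $k=0,\dots,M-1$, are positive semidefinite.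
   Context: System $A$ is $\mathbb C^M$ with orthonormal basis $\{|k\rangle_A\}_{k=0}^{M-1}$. System $B$ has Hilbert space $\mathcal H_B$, the single-mode Fock space with orthonormal Fock (number) basis $|0\rangle,|1\rangle,|2\rangle,\dots$ (or its truncation to finitely many Fock levels $|0\rangle,\dots,|N\rangle$). ''Matrix'' means bounded linear operator. The number operator is $\hat n|n\rangle=n|n\rangle$, and $U_\phi=\exp(-i\phi\hat n)$ is the phase-space rotation unitary, so $U_\theta|n\rangle=\omega_M^{-n}|n\rangle$. *)

(* Defs.v *)
From HB Require Import structures.
From mathcomp Require Import all_boot all_order all_algebra.
From mathcomp Require Import complex ring.
From mathcomp Require Import all_classical all_reals.
From mathcomp Require Import ereal numfun esum trigo.

Set Implicit Arguments.
Unset Strict Implicit.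
Unset Printing Implicit Defensive.

Import Order.TTheory GRing.Theory Num.Theory.
Local Open Scope classical_set_scope.
Local Open Scope ring_scope.
Local Open Scope complex_scope.

(* exp(i t) *)
Definition expi {R : realType} (t : R) : R[i] := cos t +i* sin t.

Definition abs2 {R : realType} (z : R[i]) : R :=
  complex.Re z ^+ 2 + complex.Im z ^+ 2.

Section Abs2.
Context {R : realType}.
Implicit Types x y z : R[i].

Lemma abs2_ge0 z : 0 <= abs2 z.
Proof. by rewrite addr_ge0// sqr_ge0. Qed.

Lemma abs20 : abs2 (0 : R[i]) = 0.
Proof. by rewrite /abs2 /= expr0n /= addr0. Qed.

Lemma abs2M x y : abs2 (x * y) = abs2 x * abs2 y.
Proof. by case: x y => [a b] [c d]; rewrite /abs2 /=; ring. Qed.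

Lemma abs2D x y : abs2 (x + y) <= 2 * abs2 x + 2 * abs2 y.
Proof.
case: x y => [a b] [c d]; rewrite /abs2 /= -subr_ge0.
rewrite [leRHS](_ : _ = (a - c) ^+ 2 + (b - d) ^+ 2); last by ring.
by rewrite addr_ge0// sqr_ge0.
Qed.

Lemma abs2_expi (t : R) : abs2 (expi t) = 1.
Proof. by rewrite /abs2 /= cos2Dsin2. Qed.

End Abs2.

(* The squared l^2 norm of an arbitrary family, as an unordered sum. *)
Definition esqnorm {R : realType} {I : choiceType} (x : I -> R[i]) : \bar R :=
  (\esum_(i in [set: I]) (abs2 (x i))%:E)%E.

Section Esqnorm.
Context {R : realType}.
Local Open Scope ereal_scope.

Lemma esqnorm_ge0 (I : choiceType) (x : I -> R[i]) : 0 <= esqnorm x.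
Proof. by apply: esum_ge0 => i _; rewrite lee_fin abs2_ge0. Qed.

Lemma esqnorm0 (I : choiceType) : esqnorm (0%R : I -> R[i]) = 0.
Proof. by apply: esum1 => i _ /=; rewrite abs20. Qed.

Lemma esumZ (I : choiceType) (c : R) (f : I -> \bar R) : (0 <= c)%R ->
  (forall i, 0 <= f i) ->
  \esum_(i in [set: I]) (c%:E * f i) = c%:E * \esum_(i in [set: I]) f i.
Proof.
move=> c0 f0; rewrite /esum -ereal_supZl//; last first.
  by apply/set0P; eexists; exists set0 => //; exact: fsets_set0.
congr ereal_sup; rewrite image_comp; apply: eq_imagel => A [fA _] /=.
by rewrite /= ge0_mule_fsumr.
Qed.

Lemma esqnormZ (I : choiceType) (a : R[i]) (x : I -> R[i]) :
  esqnorm (a *: x)%R = (abs2 a)%:E * esqnorm x.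
Proof.
rewrite -esumZ ?abs2_ge0// => [|i]; last by rewrite lee_fin abs2_ge0.
by apply: eq_esum => i _; rewrite -EFinM -abs2M.
Qed.

Lemma esqnormD (I : choiceType) (x y : I -> R[i]) :
  esqnorm (x + y)%R <= 2%:E * esqnorm x + 2%:E * esqnorm y.
Proof.
have abs0 (z : I -> R[i]) i : 0 <= (abs2 (z i))%:E by rewrite lee_fin abs2_ge0.
rewrite -!esumZ// -esumD; [|by move=> *; rewrite mule_ge0..].
by apply: le_esum => i _; rewrite -!EFinM -EFinD lee_fin abs2D.
Qed.

Lemma esqnorm_prod (I J : choiceType) (x : I * J -> R[i]) :
  esqnorm x = \esum_(i in [set: I]) esqnorm (fun j => x (i, j)).
Proof.
rewrite /esqnorm esum_esum => [|*]; last by rewrite lee_fin abs2_ge0.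
have -> : [set: I] `*`` (fun _ => [set: J]) = [set: I * J].
  by apply/seteqP; split.
by apply: eq_esum => -[].
Qed.

Lemma esqnorm_slice (I J : choiceType) (x : I * J -> R[i]) i :
  esqnorm (fun j => x (i, j)) <= esqnorm x.
Proof.
rewrite esqnorm_prod -[leLHS](@esum_set1 _ _ i (fun i => esqnorm (fun j => x (i, j)))).
  rewrite esum_mkcond [leRHS]esum_mkcond; apply: le_esum => k _.
  by rewrite in_setT; case: ifP => // _; exact: esqnorm_ge0.
exact: esqnorm_ge0.
Qed.

End Esqnorm.

Definition sqsummable {R : realType} {I : choiceType} (x : I -> R[i]) : bool :=
  (esqnorm x < +oo)%E.

Section L2.
Context {R : realType} {I : choiceType}.

Lemma sqsummable_submod : subsemimod_closed (@sqsummable R I).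
Proof.
split; first split.
- by rewrite unfold_in /sqsummable esqnorm0 ltry.
- move=> x y; rewrite !unfold_in /sqsummable => hx hy.
  by apply: le_lt_trans (esqnormD _ _) _; rewrite lte_add_pinfty// lte_mul_pinfty.
- move=> a x; rewrite !unfold_in /sqsummable => hx.
  by rewrite esqnormZ lte_mul_pinfty// lee_fin abs2_ge0.
Qed.

HB.instance Definition _ :=
  GRing.isSubmodClosed.Build R[i] (I -> R[i]) (@sqsummable R I)
    sqsummable_submod.

End L2.

(* The Hilbert space l^2(I), whose canonical orthonormal basis is indexed by
   I. *)
Record l2 (R : realType) (I : choiceType) :=
  L2 { l2_fun :> I -> R[i]; l2P : sqsummable l2_fun }.

HB.instance Definition _ (R : realType) (I : choiceType) :=
  [isSub for @l2_fun R I].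
HB.instance Definition _ (R : realType) (I : choiceType) :=
  [Choice of l2 R I by <:].
HB.instance Definition _ (R : realType) (I : choiceType) :=
  [SubChoice_isSubLmodule of l2 R I by <:].

Section Inner.
Context {R : realType} {I : choiceType}.

Definition l2norm (x : l2 R I) : R := Num.sqrt (fine (esqnorm x)).

(* Unordered sum of an absolutely summable real family, as the difference of
   the sums of its positive and negative parts. *)
Definition rsum (f : I -> R) : R :=
  fine (\esum_(i in [set: I]) ((EFin \o f)^\+ i)
        - \esum_(i in [set: I]) ((EFin \o f)^\- i))%E.

Definition csum (f : I -> R[i]) : R[i] :=
  rsum (fun i => complex.Re (f i)) +i* rsum (fun i => complex.Im (f i)).

(* Antilinear in the first argument. *)
Definition inner (x y : l2 R I) : R[i] := csum (fun i => (x i)^* * y i).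

Lemma l2_ext (x y : l2 R I) : (forall i, x i = y i) -> x = y.
Proof. by move=> h; apply/val_inj/funext. Qed.

Lemma l2D (x y : l2 R I) i : (x + y) i = x i + y i.
Proof. by []. Qed.

Lemma l2Z a (x : l2 R I) i : (a *: x) i = a * x i.
Proof. by []. Qed.

Lemma l20 i : (0 : l2 R I) i = 0.
Proof. by []. Qed.

Lemma l2_sum (J : finType) (F : J -> l2 R I) i :
  (\sum_j F j) i = \sum_j F j i.
Proof. by elim/big_ind2 : _ => [|x a y b <- <-|//]; rewrite ?l20 ?l2D. Qed.

Lemma esqnormE (x : l2 R I) : esqnorm x = (l2norm x ^+ 2)%:E.
Proof.
rewrite /l2norm sqr_sqrtr ?fineK//; last by rewrite fine_ge0// esqnorm_ge0.
by rewrite ge0_fin_numE ?esqnorm_ge0//; exact: l2P.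
Qed.

Lemma l2norm_ge0 (x : l2 R I) : 0 <= l2norm x.
Proof. exact: sqrtr_ge0. Qed.

End Inner.

Section BoundedLinear.
Context {R : realType}.

Definition bounded_linear_map {I J : choiceType} (f : l2 R I -> l2 R J) : Prop :=
  linear f /\ exists C : R, forall x, l2norm (f x) <= C * l2norm x.

Lemma bounded_linear_esqnorm {I J : choiceType} (f : l2 R I -> l2 R J) :
  bounded_linear_map f <->
  linear f /\ exists2 C : R, 0 <= C &
    forall x, (esqnorm (f x) <= C%:E * esqnorm x)%E.
Proof.
split=> -[lf].
- move=> [C hC]; split=> //; exists (C ^+ 2) => [|x]; first exact: sqr_ge0.
  rewrite !esqnormE -EFinM lee_fin -exprMn.
  by rewrite ler_sqr ?nnegrE ?l2norm_ge0// (le_trans (l2norm_ge0 (f x))).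
- move=> [C C0 hC]; split=> //; exists (Num.sqrt C) => x.
  rewrite -ler_sqr ?nnegrE ?mulr_ge0 ?l2norm_ge0 ?sqrtr_ge0//.
  by have := hC x; rewrite !esqnormE -EFinM lee_fin exprMn (sqr_sqrtr C0).
Qed.

Lemma bounded_linear0 {I J : choiceType} :
  bounded_linear_map (fun _ : l2 R I => 0 : l2 R J).
Proof.
apply/bounded_linear_esqnorm; split; first by move=> a x y; rewrite scaler0 addr0.
by exists 0 => // x; rewrite mul0e (esqnorm0 (R := R)).
Qed.

Lemma bounded_linearD {I J : choiceType} (f g : l2 R I -> l2 R J) :
  bounded_linear_map f -> bounded_linear_map g ->
  bounded_linear_map (fun x => f x + g x).
Proof.
move=> /bounded_linear_esqnorm[lf [C C0 hf]] /bounded_linear_esqnorm[lg [D D0 hg]].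
apply/bounded_linear_esqnorm; split.
  by move=> a x y; rewrite lf lg scalerDr addrACA.
exists (2 * C + 2 * D) => [|x]; first by rewrite addr_ge0// mulr_ge0.
rewrite (le_trans (esqnormD (f x) (g x)))// (EFinD (2 * C)) !EFinM.
rewrite ge0_muleDl ?mule_ge0 ?lee_fin// -!muleA.
by apply: leeD; rewrite lee_pmul2l//.
Qed.

Lemma bounded_linearZ {I J : choiceType} (a : R[i]) (f : l2 R I -> l2 R J) :
  bounded_linear_map f -> bounded_linear_map (fun x => a *: f x).
Proof.
move=> /bounded_linear_esqnorm[lf [C C0 hf]]; apply/bounded_linear_esqnorm; split.
  by move=> b x y; rewrite lf scalerDr !scalerA mulrC.
exists (abs2 a * C) => [|x]; first by rewrite mulr_ge0// abs2_ge0.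
rewrite (esqnormZ a (f x)) EFinM -muleA.
by rewrite lee_wpmul2l// lee_fin abs2_ge0.
Qed.

Lemma bounded_linear_id {I : choiceType} : bounded_linear_map (@id (l2 R I)).
Proof. by split=> //; exists 1 => x; rewrite mul1r. Qed.

Lemma bounded_linear_comp {I J K : choiceType} (f : l2 R J -> l2 R K)
    (g : l2 R I -> l2 R J) :
  bounded_linear_map f -> bounded_linear_map g -> bounded_linear_map (f \o g).
Proof.
move=> /bounded_linear_esqnorm[lf [C C0 hf]] /bounded_linear_esqnorm[lg [D D0 hg]].
apply/bounded_linear_esqnorm; split; first by move=> a x y /=; rewrite lg lf.
exists (C * D) => [|x]; first by rewrite mulr_ge0.
by rewrite (le_trans (hf _))// EFinM -muleA lee_wpmul2l.
Qed.

Lemma bounded_linear_sum {I J : choiceType} (K : Type) (r : seq K)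
    (F : K -> l2 R I -> l2 R J) :
  (forall k, bounded_linear_map (F k)) ->
  bounded_linear_map (fun x => \sum_(k <- r) F k x).
Proof.
move=> hF; elim: r => [|k r IH].
  by under eq_fun do rewrite big_nil; exact: bounded_linear0.
by under eq_fun do rewrite big_cons; exact: bounded_linearD.
Qed.

Definition is_bop {I : choiceType} (f : l2 R I -> l2 R I) : bool :=
  `[< bounded_linear_map f >].

Lemma is_bop_submod {I : choiceType} : subsemimod_closed (@is_bop I).
Proof.
split; first split.
- by apply/asboolP; exact: bounded_linear0.
- by move=> f g /asboolP hf /asboolP hg; apply/asboolP; exact: bounded_linearD.
- by move=> a f /asboolP hf; apply/asboolP; exact: bounded_linearZ.
Qed.

HB.instance Definition _ {I : choiceType} :=
  GRing.isSubmodClosed.Build R[i] (l2 R I -> l2 R I) (@is_bop I) is_bop_submod.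

End BoundedLinear.

(* Bounded linear operators on l^2(I): a complex vector space for the pointwise
   operations, a ring for composition. *)
Record bop (R : realType) (I : choiceType) :=
  Bop { bop_fun :> l2 R I -> l2 R I; bopP : is_bop bop_fun }.

HB.instance Definition _ (R : realType) (I : choiceType) :=
  [isSub for @bop_fun R I].
HB.instance Definition _ (R : realType) (I : choiceType) :=
  [Choice of bop R I by <:].
HB.instance Definition _ (R : realType) (I : choiceType) :=
  [SubChoice_isSubLmodule of bop R I by <:].

Section BopRing.
Context {R : realType} {I : choiceType}.
Implicit Types S T : bop R I.

Lemma bop_bounded T : bounded_linear_map T.
Proof. by apply/asboolP; exact: bopP. Qed.

Lemma bop_linear T : linear T.
Proof. by case: (bop_bounded T). Qed.

Lemma bop_raddf T x y : T (x + y) = T x + T y.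
Proof. by rewrite -[x]scale1r bop_linear !scale1r. Qed.

Lemma bop_scale T a x : T (a *: x) = a *: T x.
Proof.
have T0 : T 0 = 0 by apply: (addrI (T 0)); rewrite -bop_raddf !addr0.
by rewrite -[a *: x]addr0 bop_linear T0 addr0.
Qed.

Lemma bop_ext S T : (forall x, S x = T x) -> S = T.
Proof. by move=> h; apply/val_inj/funext. Qed.

Lemma bopD S T x : (S + T) x = S x + T x.
Proof. by []. Qed.

Lemma bopZ a T x : (a *: T) x = a *: T x.
Proof. by []. Qed.

Lemma bop0 x : (0 : bop R I) x = 0.
Proof. by []. Qed.

Definition bop_one : bop R I := Bop (asboolT bounded_linear_id).

Definition bop_mul S T : bop R I :=
  Bop (asboolT (bounded_linear_comp (bop_bounded S) (bop_bounded T))).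

Fact bop_mulA : associative bop_mul.
Proof. by move=> S T U; exact: bop_ext. Qed.
Fact bop_mul1 : left_id bop_one bop_mul.
Proof. by move=> T; exact: bop_ext. Qed.
Fact bop_mulr1 : right_id bop_one bop_mul.
Proof. by move=> T; exact: bop_ext. Qed.
Fact bop_mulDl : left_distributive bop_mul +%R.
Proof. by move=> S T U; exact: bop_ext. Qed.
Fact bop_mulDr : right_distributive bop_mul +%R.
Proof. by move=> S T U; apply: bop_ext => x; exact: bop_raddf. Qed.

HB.instance Definition _ := GRing.Zmodule_isPzRing.Build (bop R I)
  bop_mulA bop_mul1 bop_mulr1 bop_mulDl bop_mulDr.

Lemma bopM S T x : (S * T) x = S (T x).
Proof. by []. Qed.

(* The adjoint. It is the unique S below; one exists for every bounded T by the
   Riesz representation theorem, so the default 0 of xget is never reached. *)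
Definition adj T : bop R I :=
  xget 0 [set S : bop R I | forall x y, inner x (T y) = inner (S x) y].

Definition unitary T : Prop := adj T * T = 1 /\ T * adj T = 1.

Definition unitarily_equivalent S T : Prop :=
  exists2 V : bop R I, unitary V & T = V * S * adj V.

Definition psd T : Prop := forall x : l2 R I, 0 <= inner x (T x).

(* exp(i A) for the (possibly unbounded) self-adjoint operator A with
   A e_n = a n e_n on the canonical basis (e_n). *)
Section ExpDiag.
Variable a : I -> R.

Lemma exp_diag_subproof (x : l2 R I) : sqsummable (fun n => expi (a n) * x n).
Proof.
have := l2P x; rewrite /sqsummable; congr (_ < _)%E; apply: eq_esum => i _.
by rewrite abs2M abs2_expi mul1r.
Qed.

Lemma exp_diag_bounded :
  bounded_linear_map (fun x => L2 (exp_diag_subproof x)).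
Proof.
apply/bounded_linear_esqnorm; split.
  move=> c x y; apply: l2_ext => i; rewrite [RHS]l2D l2Z.
  by rewrite -[LHS]/(expi (a i) * (c *: x + y) i) l2D l2Z mulrDr mulrCA.
exists 1 => // x; rewrite mul1e le_eqVlt; apply/orP; left; apply/eqP.
by apply: eq_esum => i _; rewrite /= abs2M abs2_expi mul1r.
Qed.

Definition exp_diag : bop R I := Bop (asboolT exp_diag_bounded).

Lemma exp_diagE x i : exp_diag x i = expi (a i) * x i.
Proof. by []. Qed.

End ExpDiag.

End BopRing.

(* C^K (x) l^2(J), as well as the direct sum of K copies of l^2(J), is
   l^2(K * J): the vector f has the components f(k, .) in l^2(J). *)
Section Block.
Context {R : realType} {K : finType} {J : choiceType}.

Lemma component_subproof (k : K) (f : l2 R (K * J)%type) :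
  sqsummable (fun j => f (k, j)).
Proof. exact: le_lt_trans (esqnorm_slice _ _) (l2P f). Qed.

Definition component (k : K) (f : l2 R (K * J)%type) : l2 R J :=
  L2 (component_subproof k f).

Lemma component_bounded k : bounded_linear_map (component k).
Proof.
apply/bounded_linear_esqnorm; split; first by move=> c x y; exact: l2_ext.
by exists 1 => // x; rewrite mul1e; exact: esqnorm_slice.
Qed.

Variable T : K -> K -> bop R J.

Let brow k (f : l2 R (K * J)%type) : l2 R J := \sum_l T k l (component l f).

Let brow_bounded k : bounded_linear_map (brow k).
Proof.
apply: bounded_linear_sum => l.
exact: bounded_linear_comp (bop_bounded _) (component_bounded l).
Qed.

Definition block_fun (f : l2 R (K * J)%type) (p : K * J) : R[i] :=
  (\sum_l T p.1 l (component l f)) p.2.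

Let brow_esqnorm (f : l2 R (K * J)%type) :
  esqnorm (block_fun f) = (\sum_(k : K) esqnorm (brow k f))%E.
Proof.
rewrite esqnorm_prod -[LHS]/(\esum_(k in [set: K]) esqnorm (brow k f))%E.
rewrite (esum_fset finite_finset) => [|*]; last exact: esqnorm_ge0.
have -> : [set: K] = [set` index_enum K].
  by apply/seteqP; split=> k _ //=; exact: mem_index_enum.
by rewrite -fsbig_seq ?index_enum_uniq.
Qed.

Lemma block_op_subproof (f : l2 R (K * J)%type) :
  sqsummable (block_fun f).
Proof.
by rewrite /sqsummable brow_esqnorm; apply: lte_sum_pinfty => k _; exact: l2P.
Qed.

Lemma block_op_bounded :
  bounded_linear_map (fun f => L2 (block_op_subproof f)).
Proof.
apply/bounded_linear_esqnorm; split.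
  move=> c x y; apply: l2_ext => -[k j].
  by rewrite !l2D !l2Z /= -[LHS]/(brow k (c *: x + y) j) (brow_bounded k).1 l2D l2Z.
have /choice[C hC] : forall k, exists C : R, 0 <= C /\
    forall x, (esqnorm (brow k x) <= C%:E * esqnorm x)%E.
  move=> k; have /bounded_linear_esqnorm[_ [C C0 h]] := brow_bounded k.
  by exists C.
exists (\sum_k C k) => [|x]; first by apply: sumr_ge0 => k _; have [] := hC k.
rewrite brow_esqnorm -sumEFin ge0_sume_distrl; last first.
  by move=> k _; rewrite lee_fin; have [] := hC k.
by apply: lee_sum => k _; have [_] := hC k; exact.
Qed.

(* The K x K operator matrix (T k l). *)
Definition block_op : bop R (K * J)%type := Bop (asboolT block_op_bounded).

Lemma block_opE f k j : block_op f (k, j) = (\sum_l T k l (component l f)) j.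
Proof. by []. Qed.

End Block.

Definition tensor_op {R : realType} {M : nat} {J : choiceType}
    (A : 'M[R[i]]_M) (B : bop R J) : bop R ('I_M * J)%type :=
  block_op (fun k l => A k l *: B).

(* |k><l| *)
Definition ketbra {R : realType} {M : nat} (k l : 'I_M) : 'M[R[i]]_M :=
  delta_mx k l.

Definition direct_sum_op {R : realType} {K : finType} {J : choiceType}
    (E : K -> bop R J) : bop R (K * J)%type :=
  block_op (fun k l => if k == l then E k else 0).

Lemma tensor_opE {R : realType} {M : nat} {J : choiceType}
    (A : 'M[R[i]]_M) (B : bop R J) (f : l2 R ('I_M * J)%type)
    (u : 'cV[R[i]]_M) (v : l2 R J) :
  (forall k j, f (k, j) = u k ord0 * v j) ->
  forall k j, tensor_op A B f (k, j) = (A *m u) k ord0 * B v j.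
Proof.
move=> fE k j; rewrite block_opE l2_sum mxE mulr_suml.
apply: eq_bigr => l _; rewrite bopZ l2Z -mulrA; congr (_ * _).
have -> : component l f = u l ord0 *: v.
  by apply: l2_ext => i; rewrite l2Z -fE.
by rewrite bop_scale l2Z.
Qed.

Lemma direct_sum_opE {R : realType} {K : finType} {J : choiceType}
    (E : K -> bop R J) f k j : direct_sum_op E f (k, j) = E k (component k f) j.
Proof.
rewrite block_opE l2_sum (bigD1 k)//= eqxx big1 ?addr0// => l /negPf lk.
by rewrite eq_sym lk bop0 l20.
Qed.

(* The Fock levels: all of nat (cutoff None), or 0, ..., N (cutoff Some N). *)
Definition in_cutoff (cutoff : option nat) (n : nat) : bool :=
  if cutoff is Some N then (n <= N)%N else true.

Definition fock_level (cutoff : option nat) : choiceType :=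
  {n : nat | in_cutoff cutoff n}.

(* U_phi = exp(- i phi n), n the number operator. *)
Definition rotation {R : realType} (cutoff : option nat) (phi : R) :
    bop R (fock_level cutoff) :=
  exp_diag (fun n : fock_level cutoff => - (phi * (val n)%:R)).

(* Main.v *)
Require Import Defs.
From mathcomp Require Import all_boot all_order all_algebra.
From mathcomp Require Import complex ring lra.
From mathcomp Require Import all_classical all_reals.
From mathcomp Require Import ereal numfun esum trigo.

Set Implicit Arguments.
Unset Strict Implicit.
Unset Printing Implicit Defensive.

Import Order.TTheory GRing.Theory Num.Theory.
Local Open Scope ring_scope.
Local Open Scope complex_scope.

(* Covariance says tau_kl = U^k tau_{0,l-k} U^-k, so conjugating tauAB by
   diag (U^-k) yields the block circulant matrix with entries
   C_{l-k} / M, where C_m = tau_{0m} U^m.  The discrete Fourier transform on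
   C^M diagonalizes it, with diagonal blocks E_k = (1/M) sum_m omega^(k m) C_m.
   The product V of the two unitaries is thus a unitary with V tauAB = D V;
   positivity is invariant under unitary conjugation, and D is positive iff
   its blocks are. *)

(** * Additivity of unordered sums of real families *)

Section UnorderedSums.
Local Open Scope classical_set_scope.
Context {R : realType}.

Lemma esum_supp1 (I : choiceType) (j : I) (h : I -> \bar R) :
  (forall i, 0 <= h i)%E -> (forall i, i != j -> h i = 0)%E ->
  (\esum_(i in [set: I]) h i)%E = h j.
Proof.
move=> h0 hj; rewrite -[RHS](esum_set1 (t := j))// esum_mkcond [RHS]esum_mkcond.
apply: eq_esum => i _; rewrite in_setT.
by case: ifPn => //; rewrite notin_setE /= => /eqP/hj.
Qed.

Lemma esum_fin_prod (K : finType) (J : choiceType) (h : K * J -> \bar R) :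
  (forall p, 0 <= h p)%E ->
  (\esum_(p in [set: K * J]) h p = \sum_k \esum_(j in [set: J]) h (k, j))%E.
Proof.
move=> h0.
have -> : (\esum_(p in [set: K * J]) h p)%E =
    (\esum_(k in [set: K]) \esum_(j in [set: J]) h (k, j))%E.
  rewrite esum_esum//.
  have -> : [set: K] `*`` (fun _ => [set: J]) = [set: K * J].
    by apply/seteqP; split.
  by apply: eq_esum => -[].
rewrite (esum_fset finite_finset) => [|*]; last exact: esum_ge0.
have -> : [set: K] = [set` index_enum K].
  by apply/seteqP; split=> k _ //=; exact: mem_index_enum.
by rewrite -fsbig_seq ?index_enum_uniq.
Qed.

(** Bounds both sums in [rsum], so their difference is finite and [fine] takes no default value. *)
Definition abs_summable (I : choiceType) (f : I -> R) : Prop :=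
  ((\esum_(i in [set: I]) `|f i|%:E)%E < +oo)%E.

Lemma abs_summable_le (I : choiceType) (f g : I -> R) :
  (forall i, `|f i| <= g i) -> (\esum_(i in [set: I]) (g i)%:E < +oo)%E ->
  abs_summable f.
Proof.
by move=> fg; apply: le_lt_trans; apply: le_esum => i _; rewrite lee_fin.
Qed.

(* Any decomposition into nonnegative summable families may replace the one
   into positive and negative parts. *)
Lemma rsum_decomposition (I : choiceType) (f g h : I -> R) :
  (forall i, 0 <= g i) -> (forall i, 0 <= h i) ->
  (\esum_(i in [set: I]) (g i)%:E < +oo)%E ->
  (\esum_(i in [set: I]) (h i)%:E < +oo)%E ->
  (forall i, f i = g i - h i) ->
  rsum f = fine (\esum_(i in [set: I]) (g i)%:E)%E
         - fine (\esum_(i in [set: I]) (h i)%:E)%E.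
Proof.
move=> g0 h0 gy hy fE.
have fin (k : I -> \bar R) (k' : I -> R) : (forall i, 0 <= k i <= (k' i)%:E)%E ->
    (\esum_(i in [set: I]) (k' i)%:E < +oo)%E ->
    (\esum_(i in [set: I]) k i)%E \is a fin_num.
  move=> kk' ky; rewrite ge0_fin_numE; last first.
    by apply: esum_ge0 => i _; case/andP: (kk' i).
  by apply: le_lt_trans ky; apply: le_esum => i _; case/andP: (kk' i).
have posf i : (0 <= (EFin \o f)^\+ i <= (g i)%:E)%E.
  rewrite funepos_ge0 funeposE /= fE -EFin_max lee_fin ge_max g0 andbT.
  by rewrite gerBl h0.
have negf i : (0 <= (EFin \o f)^\- i <= (h i)%:E)%E.
  rewrite funeneg_ge0 funenegE /= fE -?EFinN -EFin_max lee_fin ge_max h0 andbT.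
  by rewrite opprB gerBl g0.
have gfin : (\esum_(i in [set: I]) (g i)%:E)%E \is a fin_num.
  by apply: (fin _ g) => // i; rewrite lexx lee_fin g0.
have hfin : (\esum_(i in [set: I]) (h i)%:E)%E \is a fin_num.
  by apply: (fin _ h) => // i; rewrite lexx lee_fin h0.
have pfin := fin _ _ posf gy; have nfin := fin _ _ negf hy.
(* The equality of differences is rearranged so that both sides are sums of nonnegative families, to
   which [esumD] applies; finiteness of the four sums then permits subtracting back. *)
have : (\esum_(i in [set: I]) (EFin \o f)^\+ i +
        \esum_(i in [set: I]) (h i)%:E =
        \esum_(i in [set: I]) (EFin \o f)^\- i +
        \esum_(i in [set: I]) (g i)%:E)%E.
  rewrite -!esumD; do ?[by move=> i _; rewrite lee_fin
    | by move=> i _; case/andP: (posf i) | by move=> i _; case/andP: (negf i)].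
  apply: eq_esum => i _; rewrite funeposE funenegE /= -?EFinN -!EFin_max -!EFinD.
  congr EFin; rewrite fE opprB; case: (leP (h i) (g i)) => gh.
    rewrite max_l ?subr_ge0// max_r ?subr_le0//; ring.
  rewrite max_r ?subr_le0 ?(ltW gh)// max_l ?subr_ge0 ?(ltW gh)//; ring.
rewrite /rsum -(fineK pfin) -(fineK nfin) -(fineK gfin) -(fineK hfin) -!EFinD.
by case=> /= e; move: e; lra.
Qed.

Lemma rsum_posneg (I : choiceType) (f : I -> R) : abs_summable f ->
  let p i := Num.max (f i) 0 in let n i := Num.max (- f i) 0 in
  [/\ (\esum_(i in [set: I]) (p i)%:E < +oo)%E,
      (\esum_(i in [set: I]) (n i)%:E < +oo)%E
    & forall i, f i = p i - n i].
Proof.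
move=> sf p n; split.
- apply: le_lt_trans sf; apply: le_esum => i _.
  by rewrite lee_fin /p ge_max ler_norm normr_ge0.
- apply: le_lt_trans sf; apply: le_esum => i _.
  by rewrite lee_fin /n ge_max -normrN ler_norm normr_ge0.
- move=> i; rewrite /p /n; case: (leP 0 (f i)) => f0.
    by rewrite max_r ?oppr_le0// subr0.
  by rewrite max_l ?oppr_ge0 ?ltW// sub0r opprK.
Qed.

(** The sums of the positive parts and of the negative parts decompose [f + g], but are not in
    general its own positive and negative parts; [rsum_decomposition] bridges this gap. *)
Lemma rsumD (I : choiceType) (f g : I -> R) :
  abs_summable f -> abs_summable g ->
  rsum (fun i => f i + g i) = rsum f + rsum g.
Proof.
move=> /rsum_posneg/= [pf nf fE] /rsum_posneg/= [pg ng gE].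
have m0 (x : R) : 0 <= Num.max x 0 by rewrite le_max lexx orbT.
have e0 (x : R) : (0%:E <= (Num.max x 0)%:E)%E by rewrite lee_fin m0.
have fin (k : I -> R) : (\esum_(i in [set: I]) (Num.max (k i) 0)%:E < +oo)%E ->
    (\esum_(i in [set: I]) (Num.max (k i) 0)%:E)%E \is a fin_num.
  by move=> ?; rewrite ge0_fin_numE// esum_ge0.
rewrite (rsum_decomposition _ _ pf nf fE)// (rsum_decomposition _ _ pg ng gE)//.
have sD (h k : I -> R) :
    (\esum_(i in [set: I]) (Num.max (h i) 0 + Num.max (k i) 0)%:E =
     \esum_(i in [set: I]) (Num.max (h i) 0)%:E +
     \esum_(i in [set: I]) (Num.max (k i) 0)%:E)%E.
  by rewrite -esumD => [|i _|i _]; rewrite ?e0.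
rewrite (@rsum_decomposition _ _
  (fun i => Num.max (f i) 0 + Num.max (g i) 0)
  (fun i => Num.max (- f i) 0 + Num.max (- g i) 0)).
- by rewrite !sD !fineD ?fin//; ring.
- by move=> i; rewrite addr_ge0.
- by move=> i; rewrite addr_ge0.
- by rewrite sD lte_add_pinfty.
- by rewrite sD lte_add_pinfty.
- by move=> i; move: (fE i) (gE i) => /=; lra.
Qed.

(** Positive and negative parts are split separately, where nonnegativity allows iterated summation.
    Every slice is bounded by the whole sum, hence finite, so [fine] commutes with the sum over
    [K]. *)
Lemma rsum_fin_prod (K : finType) (J : choiceType) (f : K * J -> R) :
  abs_summable f -> rsum f = \sum_k rsum (fun j => f (k, j)).
Proof.
move=> /rsum_posneg/= [pf nf fE].
have m0 (x : R) : 0 <= Num.max x 0 by rewrite le_max lexx orbT.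
have e0 (x : R) : (0%:E <= (Num.max x 0)%:E)%E by rewrite lee_fin m0.
have slice (h : K * J -> R) k :
    (\esum_(p in [set: K * J]) (Num.max (h p) 0)%:E < +oo)%E ->
    (\esum_(j in [set: J]) (Num.max (h (k, j)) 0)%:E < +oo)%E.
  apply: le_lt_trans; rewrite esum_fin_prod// (bigD1 k)//= leeDl//.
  by apply: sume_ge0 => l _; exact: esum_ge0.
have fineS (h : K * J -> R) :
    (\esum_(p in [set: K * J]) (Num.max (h p) 0)%:E < +oo)%E ->
    fine (\esum_(p in [set: K * J]) (Num.max (h p) 0)%:E)%E =
    \sum_k fine (\esum_(j in [set: J]) (Num.max (h (k, j)) 0)%:E)%E.
  move=> hy; rewrite esum_fin_prod// -sum_fine// => k _.
  by rewrite ge0_fin_numE ?esum_ge0//; exact: (slice h).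
rewrite (rsum_decomposition _ _ pf nf fE)// !fineS// -sumrB.
apply: eq_bigr => k _; apply/esym/rsum_decomposition => //.
- exact: slice pf.
- exact: (slice (fun p => - f p)).
Qed.

Lemma rsum_supp1 (I : choiceType) (j : I) (f : I -> R) :
  (forall i, i != j -> f i = 0) -> rsum f = f j.
Proof.
move=> fj; rewrite /rsum !(esum_supp1 (j := j)) //.
- rewrite funeposE funenegE /= -?EFinN -!EFin_max -EFinB /=.
  case: (leP 0 (f j)) => f0; first by rewrite max_r ?oppr_le0// subr0.
  by rewrite max_l ?oppr_ge0 ?ltW// sub0r opprK.
- by move=> i /fj fi; rewrite funenegE /= fi oppr0 maxxx.
- by move=> i /fj fi; rewrite funeposE /= fi maxxx.
Qed.

End UnorderedSums.

Lemma conjcM (R : rcfType) (x y : R[i]) : (x * y)^*%C = x^*%C * y^*%C.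
Proof. exact: rmorphM. Qed.

Lemma conjcX (R : rcfType) (x : R[i]) m : (x ^+ m)^*%C = x^*%C ^+ m.
Proof. exact: rmorphXn. Qed.

(** * Sesquilinearity of the inner product on l^2 *)

Section InnerProduct.
Context {R : realType}.

Section Space.
Context {I : choiceType}.
Implicit Types x y z : l2 R I.

(** Both parts of each term are bounded in absolute value by [abs2 (x i) + abs2 (y i)], which is
    summable. This makes the [rsum] lemmas applicable to [inner]. *)
Lemma inner_summable x y :
  abs_summable (fun i => complex.Re ((x i)^* * y i)) /\
  abs_summable (fun i => complex.Im ((x i)^* * y i)).
Proof.
have hy : (\esum_(i in [set: I]) (abs2 (x i) + abs2 (y i))%:E < +oo)%E.
  rewrite (_ : (\esum_(i in _) _)%E = (esqnorm x + esqnorm y)%E).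
    by rewrite lte_add_pinfty//; exact: l2P.
  by rewrite /esqnorm -esumD// => i _; rewrite lee_fin abs2_ge0.
split; apply: abs_summable_le hy => i.
all: case: (x i) (y i) => [a b] [c d]; rewrite /abs2 /= ler_norml.
(* The real part is ac + bd; the squares of a ± c and b ± d bound |ac| and |bd|. The imaginary part
   ad - bc is treated in the same way with a ± d and b ± c. *)
- have := sqr_ge0 (a + c); have := sqr_ge0 (b + d).
  have := sqr_ge0 (a - c); have := sqr_ge0 (b - d).
  have := sqr_ge0 a; have := sqr_ge0 b; have := sqr_ge0 c; have := sqr_ge0 d.
  by move=> *; apply/andP; split; nra.
- have := sqr_ge0 (a + d); have := sqr_ge0 (b + c).
  have := sqr_ge0 (a - d); have := sqr_ge0 (b - c).
  have := sqr_ge0 a; have := sqr_ge0 b; have := sqr_ge0 c; have := sqr_ge0 d.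
  by move=> *; apply/andP; split; nra.
Qed.

Lemma csumD (f g : I -> R[i]) :
  abs_summable (fun i => complex.Re (f i)) ->
  abs_summable (fun i => complex.Im (f i)) ->
  abs_summable (fun i => complex.Re (g i)) ->
  abs_summable (fun i => complex.Im (g i)) ->
  csum (fun i => f i + g i) = csum f + csum g.
Proof.
move=> rf jf rg jg; rewrite /csum.
rewrite [RHS](_ : _ =
  (rsum (fun i => complex.Re (f i)) + rsum (fun i => complex.Re (g i))) +i*
  (rsum (fun i => complex.Im (f i)) + rsum (fun i => complex.Im (g i))))//.
congr Complex; rewrite -rsumD//; congr rsum;
  by apply/funext => i; case: (f i) (g i) => [? ?] [].
Qed.

Lemma innerDr x y z : inner x (y + z) = inner x y + inner x z.
Proof.
have [? ?] := inner_summable x y; have [? ?] := inner_summable x z.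
rewrite -csumD//; congr csum; apply/funext => i.
by rewrite l2D mulrDr.
Qed.

Lemma innerDl x y z : inner (x + y) z = inner x z + inner y z.
Proof.
have [? ?] := inner_summable x z; have [? ?] := inner_summable y z.
rewrite -csumD//; congr csum; apply/funext => i.
by rewrite l2D rmorphD mulrDl.
Qed.

Lemma inner0r x : inner x 0 = 0.
Proof. by apply: (addrI (inner x 0)); rewrite -innerDr !addr0. Qed.

Lemma inner_sumr (K : finType) x (F : K -> l2 R I) :
  inner x (\sum_k F k) = \sum_k inner x (F k).
Proof.
apply: (big_morph (inner x)) => [y z|]; first exact: innerDr.
exact: inner0r.
Qed.

Lemma inner_suml (K : finType) x (F : K -> l2 R I) :
  inner (\sum_k F k) x = \sum_k inner (F k) x.
Proof.
apply: (big_morph (inner^~ x)) => [y z|]; first exact: innerDl.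
by apply: (addrI (inner 0 x)); rewrite -innerDl !addr0.
Qed.

Lemma delta_subproof (j : I) :
  sqsummable (fun i => if i == j then 1 else 0 : R[i]).
Proof.
rewrite /sqsummable /esqnorm (esum_supp1 (j := j)) ?ltry// => i.
  by rewrite lee_fin abs2_ge0.
by move=> /negPf ->; rewrite abs20.
Qed.

Definition l2_delta (j : I) : l2 R I := L2 (delta_subproof j).

(** Pairing with basis vectors recovers coordinates, which yields uniqueness of adjoints. *)
Lemma inner_delta x j : inner x (l2_delta j) = (x j)^*.
Proof.
have E i : (x i)^* * l2_delta j i = if i == j then (x i)^* else 0.
  by rewrite /=; case: ifP; rewrite ?mulr1 ?mulr0.
rewrite /inner /csum !(rsum_supp1 (j := j)) => [|i /negPf ij|i /negPf ij];
  rewrite ?E ?eqxx ?ij //.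
by case: (x j).
Qed.

End Space.

Lemma inner_component (K : finType) (J : choiceType) (x y : l2 R (K * J)%type) :
  inner x y = \sum_k inner (component k x) (component k y).
Proof.
have [sr si] := inner_summable x y.
rewrite /inner /csum !rsum_fin_prod//.
apply: (big_rec3 (fun (a b : R) (c : R[i]) => a +i* b = c)) => // k a b c _ <-.
by [].
Qed.

End InnerProduct.

(** * Adjoints and positivity under conjugation *)

Section Adjoints.
Context {R : realType}.

(** A relation rather than the function [adj], so that explicit adjoints can be exhibited and
    composed; [is_adjoint_adj] converts them to values of [adj]. *)
Definition is_adjoint {I : choiceType} (T S : bop R I) : Prop :=
  forall x y, inner x (T y) = inner (S x) y.

Section Space.
Context {I : choiceType}.
Implicit Types S T : bop R I.

(** The given [S] shows that the set in [xget] is inhabited, so [adj T] satisfies the defining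
    relation; two operators satisfying it have equal coordinates by [inner_delta]. *)
Lemma is_adjoint_adj T S : is_adjoint T S -> adj T = S.
Proof.
move=> TS; have : is_adjoint T (adj T) := xgetPex 0 (ex_intro _ S TS).
move=> TS'; apply: bop_ext => x; apply: l2_ext => i.
by apply: (can_inj (@conjcK R)); rewrite -!inner_delta -TS -TS'.
Qed.

Lemma innerZr a (x y : l2 R I) : inner x (a *: y) = inner (a^*%C *: x) y.
Proof.
congr csum; apply/funext => i; rewrite !l2Z (rmorphM (@conjc R)) /=.
by rewrite conjcK mulrCA mulrA.
Qed.

Lemma is_adjointZ a T S : is_adjoint T S -> is_adjoint (a *: T) (a^*%C *: S).
Proof. by move=> TS x y; rewrite !bopZ innerZr TS bop_scale. Qed.

Lemma is_adjoint1 : is_adjoint (1 : bop R I) 1.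
Proof. by []. Qed.

Lemma is_adjointM T T' S S' : is_adjoint T S -> is_adjoint T' S' ->
  is_adjoint (T * T') (S' * S).
Proof. by move=> TS TS' x y; rewrite !bopM TS TS'. Qed.

Lemma is_adjointX T S n : is_adjoint T S -> is_adjoint (T ^+ n) (S ^+ n).
Proof.
move=> TS; elim: n => [|n IH]; first exact: is_adjoint1.
by rewrite exprS exprSr; exact: is_adjointM.
Qed.

Lemma exp_diag_adjoint (a : I -> R) :
  is_adjoint (exp_diag a) (exp_diag (fun i => - a i)).
Proof.
move=> x y; congr csum; apply/funext => i; rewrite !exp_diagE (rmorphM (@conjc R)) /=.
rewrite mulrCA mulrA; congr (_ * _ * _).
by rewrite /expi cosN sinN /= opprK.
Qed.

Lemma psd_conj (V W T : bop R I) : is_adjoint V W -> psd T -> psd (V * T * W).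
Proof. by move=> VW pT x; rewrite !bopM VW. Qed.

Lemma psd_unitary_conj (V W T : bop R I) : is_adjoint V W -> W * V = 1 ->
  psd (V * T * W) <-> psd T.
Proof.
move=> VW WV; split; last exact: psd_conj.
(* Testing at [V x] turns the form of [V * T * W] into that of [T] at [W (V x)], which is [x]. *)
move=> pT x; have := pT (V x); rewrite !bopM VW.
by have -> : W (V x) = x by rewrite -bopM WV.
Qed.

End Space.

(** Operator form of the conjugate transpose: expand both sides into double sums of component inner
    products and exchange the sums. *)
Lemma block_adjoint (K : finType) (J : choiceType) (T S : K -> K -> bop R J) :
  (forall k l, is_adjoint (T k l) (S l k)) ->
  is_adjoint (block_op T) (block_op S).
Proof.
move=> TS x y; rewrite !inner_component.
have comp (U : K -> K -> bop R J) f k :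
    component k (block_op U f) = \sum_l U k l (component l f).
  exact: l2_ext.
under eq_bigr do rewrite comp inner_sumr.
under [RHS]eq_bigr do rewrite comp inner_suml.
rewrite exchange_big/=; apply: eq_bigr => l _; apply: eq_bigr => k _; exact: TS.
Qed.

End Adjoints.

(** * Algebra of operator matrices *)

Section Blocks.
Context {R : realType}.

Lemma bop_mulZl (I : choiceType) a (S T : bop R I) : (a *: S) * T = a *: (S * T).
Proof. exact: bop_ext. Qed.

Lemma bop_mulZr (I : choiceType) a (S T : bop R I) : S * (a *: T) = a *: (S * T).
Proof. by apply: bop_ext => x; rewrite bopM !bopZ bop_scale. Qed.

Lemma bop_sum (I : choiceType) (K : finType) (F : K -> bop R I) x :
  (\sum_k F k) x = \sum_k F k x.
Proof. by elim/big_ind2 : _ => [|S a T b <- <-|//]; rewrite ?bop0 ?bopD. Qed.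

Lemma bopr0 (I : choiceType) (T : bop R I) : T 0 = 0.
Proof. by rewrite -[X in T X](scale0r 0) bop_scale scale0r. Qed.

Lemma bop_sumr (I : choiceType) (K : finType) (T : bop R I) (F : K -> l2 R I) :
  T (\sum_k F k) = \sum_k T (F k).
Proof.
apply: (big_morph T) => [x y|]; first exact: bop_raddf.
exact: bopr0.
Qed.

Context {K : finType} {J : choiceType}.
Implicit Types S T : K -> K -> bop R J.

Lemma component_block T f k :
  component k (block_op T f) = \sum_l T k l (component l f).
Proof. exact: l2_ext. Qed.

Lemma component_ext (f g : l2 R (K * J)%type) :
  (forall k, component k f = component k g) -> f = g.
Proof.
by move=> fg; apply: l2_ext => -[k j]; have /(congr1 (fun h : l2 R J => h j)) := fg k.
Qed.

Lemma block_op_eq S T : (forall k l, S k l = T k l) -> block_op S = block_op T.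
Proof.
by move=> ST; congr block_op; apply/funext => k; apply/funext => l.
Qed.

Lemma block_opM S T :
  block_op S * block_op T = block_op (fun k l => \sum_m S k m * T m l).
Proof.
apply: bop_ext => f; apply: component_ext => k; rewrite bopM !component_block.
under eq_bigr do rewrite component_block bop_sumr.
by rewrite exchange_big; apply: eq_bigr => l _; rewrite bop_sum.
Qed.

Lemma block_opZ a T : a *: block_op T = block_op (fun k l => a *: T k l).
Proof.
apply: bop_ext => f; apply: l2_ext => -[k j].
rewrite bopZ l2Z !block_opE !l2_sum mulr_sumr.
by apply: eq_bigr => l _; rewrite bopZ l2Z.
Qed.

Lemma block_op_sum (L : finType) (F : L -> K -> K -> bop R J) :
  \sum_i block_op (F i) = block_op (fun k l => \sum_i F i k l).
Proof.
apply: bop_ext => f; apply: l2_ext => -[k j].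
rewrite bop_sum l2_sum block_opE l2_sum.
under [RHS]eq_bigr do rewrite bop_sum l2_sum.
by rewrite exchange_big; apply: eq_bigr => i _; rewrite block_opE l2_sum.
Qed.

Lemma direct_sum_op1 : direct_sum_op (fun _ : K => 1 : bop R J) = 1.
Proof. by apply: bop_ext => f; apply: l2_ext => -[k j]; rewrite direct_sum_opE. Qed.

Lemma direct_sum_opM (E : K -> bop R J) T :
  direct_sum_op E * block_op T = block_op (fun k l => E k * T k l).
Proof.
rewrite block_opM; apply: block_op_eq => k l.
rewrite (bigD1 k)//= eqxx big1 ?addr0// => m /negPf mk.
by rewrite eq_sym mk mul0r.
Qed.

(** The inclusion of the [k]-th summand, used to test positivity of a single block. *)
Lemma embed_subproof (k : K) (v : l2 R J) :
  sqsummable (fun p : K * J => if p.1 == k then v p.2 else 0).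
Proof.
rewrite /sqsummable /esqnorm esum_fin_prod; last first.
  by move=> p; rewrite lee_fin abs2_ge0.
apply: lte_sum_pinfty => l _ /=; case: (l == k); first exact: l2P.
by rewrite esum1 ?ltry// => j _; rewrite abs20.
Qed.

(** The quadratic form of the direct sum is the sum of the forms of the blocks; on a vector
    supported in the [k]-th summand only the form of [E k] survives. *)
Lemma psd_direct_sum (E : K -> bop R J) :
  psd (direct_sum_op E) <-> forall k, psd (E k).
Proof.
have DE x : inner x (direct_sum_op E x) =
    \sum_k inner (component k x) (E k (component k x)).
  rewrite inner_component; apply: eq_bigr => k _; congr inner.
  by apply: l2_ext => j; rewrite -direct_sum_opE.
split=> [pD k v|pE x]; last by rewrite DE; apply: sumr_ge0 => k _; exact: pE.
have := pD (L2 (embed_subproof k v)); rewrite DE (bigD1 k)//= big1 ?addr0.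
  suff -> : component k (L2 (embed_subproof k v)) = v by [].
  by apply: l2_ext => j /=; rewrite eqxx.
move=> l lk; suff -> : component l (L2 (embed_subproof k v)) = 0.
  by rewrite bopr0 inner0r.
by apply: l2_ext => j /=; rewrite (negPf lk).
Qed.

End Blocks.

Lemma sum_tensor_ketbra {R : realType} (M : nat) (J : choiceType)
    (tau : 'I_M -> 'I_M -> bop R J) :
  \sum_(k < M) \sum_(l < M) tensor_op (ketbra k l) (tau k l) = block_op tau.
Proof.
under eq_bigr do rewrite /tensor_op block_op_sum.
rewrite block_op_sum; apply: block_op_eq => k l.
rewrite (bigD1 k)//= [X in _ + X]big1 => [|a ak]; last first.
  by apply: big1 => b _; rewrite mxE eq_sym (negPf ak) scale0r.
rewrite addr0 (bigD1 l)//= big1 => [|b bl].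
  by rewrite addr0 mxE !eqxx scale1r.
by rewrite mxE [l == b]eq_sym (negPf bl) andbF scale0r.
Qed.

(** * Powers with cyclic exponents and orthogonality of characters *)

Lemma expr_mul_eq1 (A : pzRingType) (x y : A) m :
  x * y = 1 -> x ^+ m * y ^+ m = 1.
Proof.
move=> xy; elim: m => [|m IH]; first by rewrite mulr1.
by rewrite exprSr exprS mulrA -(mulrA _ x) xy mulr1.
Qed.

(** Subtraction in ['I_n.+1] is modulo [n.+1], harmless in the exponent since [x ^+ n.+1 = 1].
    Stated for a ring so as to serve both the operator [W] and the scalars [w ^+ a]. *)
Lemma expr_ordB (A : pzRingType) (n : nat) (x y : A) (k l : 'I_n.+1) :
  x ^+ n.+1 = 1 -> y * x = 1 -> x ^+ (k - l)%R = y ^+ l * x ^+ k.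
Proof.
move=> xn yx; rewrite -[LHS]mul1r -(expr_mul_eq1 l yx) -mulrA -exprD.
rewrite -(expr_mod _ xn); congr (_ * _ ^+ _).
by rewrite -[LHS]/(val (l + (k - l))) addrC subrK.
Qed.

(** Orthogonality of characters: the ratio z satisfies 0 = z^M - 1 = (z - 1) times the sum, and z =
    1 forces a = b by primitivity, as both exponents are below M. *)
Lemma sum_prim_root_ratio (F : fieldType) (M : nat) (w : F) (a b : 'I_M) :
  M.-primitive_root w ->
  \sum_(l < M) (w ^+ a / w ^+ b) ^+ l = if a == b then M%:R else 0.
Proof.
move=> wM; have w0 : w != 0 by rewrite (prim_root_eq0 wM) -lt0n (prim_order_gt0 wM).
case: (eqVneq a b) => [->|ab].
  rewrite divff ?expf_neq0//; under eq_bigr do rewrite expr1n.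
  by rewrite sumr_const card_ord.
have : (w ^+ a / w ^+ b) ^+ M - 1 = 0.
  by rewrite expr_div_n -!exprM ![(_ * M)%N]mulnC !exprM
    (prim_expr_order wM) !expr1n divr1 subrr.
rewrite subrX1 => /eqP; rewrite mulf_eq0 => /orP[|/eqP//].
rewrite subr_eq0 => /eqP e.
have : w ^+ a == w ^+ b by rewrite -[w ^+ a](divfK (expf_neq0 b w0)) e mul1r.
by rewrite (eq_prim_root_expr wM) !modn_small// => /eqP/val_inj/eqP; rewrite (negPf ab).
Qed.

(** * The complex exponential and its primitive roots of unity *)

Section Expi.
Context {R : realType}.
Implicit Types t : R.

Lemma expiD s t : expi (s + t) = expi s * expi t.
Proof. by rewrite /expi cosD sinD [sin s * _ + _]addrC. Qed.

Lemma expi0 : expi (0 : R) = 1.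
Proof. by rewrite /expi cos0 sin0. Qed.

Lemma expiX t m : expi t ^+ m = expi (t * m%:R).
Proof.
elim: m => [|m IH]; first by rewrite mulr0 expi0.
by rewrite exprSr IH -expiD -natr1 mulrDr mulr1.
Qed.

Lemma expiN t : expi (- t) = (expi t)^-1.
Proof.
by apply/esym/mulr1_eq; rewrite -expiD subrr expi0.
Qed.

Lemma conj_expi t : (expi t)^*%C = (expi t)^-1.
Proof. by rewrite -expiN /expi cosN sinN. Qed.

Lemma expi2pi : expi (2 * pi : R) = 1.
Proof. by rewrite /expi mulr_natl cos2pi sin2pi. Qed.

Lemma expi_neq1 t : 0 < t < 2 * pi -> expi t != 1.
Proof.
move=> /andP[t0 tpi]; rewrite eq_complex /= negb_and; apply/orP; left.
(* Half angle: cos t = 1 - 2 sin^2 (t/2), and t/2 lies in (0, pi), where the sine is positive. *)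
rewrite (_ : t = t / 2 *+ 2); last by rewrite -mulr_natr divfK.
rewrite cos_mulr2n cos2sin2 lt_eqF//.
have : 0 < sin (t / 2) ^+ 2.
  by rewrite exprn_gt0// sin_gt0_pi//; apply/andP; split; lra.
by lra.
Qed.

Lemma expi_primitive_root M : (0 < M)%N ->
  M.-primitive_root (expi (2 * pi / M%:R : R)).
Proof.
move=> M0; have M0R : 0 < M%:R :> R by rewrite ltr0n.
apply/andP; split=> //; apply/forallP => i; rewrite unity_rootE expiX.
have [->|iM] := eqVneq i.+1 M.
  by rewrite divfK ?lt0r_neq0// expi2pi !eqxx.
rewrite (negPf (expi_neq1 _))//; apply/andP; split.
  by rewrite !mulr_gt0 ?invr_gt0 ?pi_gt0.
rewrite -mulrA gtr_pMr ?mulr_gt0 ?pi_gt0// mulrC ltr_pdivrMr// mul1r ltr_nat.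
by rewrite ltn_neqAle iM ltn_ord.
Qed.

End Expi.

(** * Diagonalization by the rotated Fourier transform *)

Section RotatedFourier.
Context {R : realType} {J : choiceType}.
Variables (n : nat) (w : R[i]) (U W : bop R J).
Let M := n.+1.
Hypotheses (wM : M.-primitive_root w) (w_conj : w^*%C = w^-1).
Hypothesis WU : is_adjoint W U.
Hypotheses (UWE : U * W = 1) (WUE : W * U = 1) (WM : W ^+ M = 1).

(** The factor 1 / sqrt M that makes the discrete Fourier transform unitary; being real, it is its
    own conjugate. *)
Let c : R[i] := ((Num.sqrt (M%:R : R))^-1)%:C.

Let cc : c * c = M%:R^-1.
Proof.
rewrite -rmorphM -invfM -expr2 sqr_sqrtr ?ler0n//.
by rewrite fmorphV rmorph_nat.
Qed.

Let c_conj : c^*%C = c.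
Proof. exact: conjc_real. Qed.

Let w_neq0 : w != 0.
Proof. by rewrite (prim_root_eq0 wM). Qed.

(** The Fourier kernel w^(-al) / sqrt M times the diagonal rotation [W ^+ l], where [W] stands for
    the adjoint of [U]. *)
Definition rot_fourier_entry (a l : 'I_M) : bop R J :=
  (c * (w ^+ (a * l))^-1) *: W ^+ l.
Definition rot_fourier_inv_entry (l a : 'I_M) : bop R J :=
  (c * w ^+ (a * l)) *: U ^+ l.

Definition rot_fourier := block_op rot_fourier_entry.
Definition rot_fourier_inv := block_op rot_fourier_inv_entry.

Let M_neq0 : M%:R != 0 :> R[i].
Proof. by rewrite pnatr_eq0. Qed.

Lemma rot_fourier_adjoint : is_adjoint rot_fourier rot_fourier_inv.
Proof.
apply: block_adjoint => a l; rewrite /rot_fourier_inv_entry.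
have -> : c * w ^+ (a * l) = (c * (w ^+ (a * l))^-1)^*%C.
  by rewrite conjcM c_conj conjc_inv
    conjcX w_conj exprVn invrK.
exact/is_adjointZ/is_adjointX.
Qed.

(** In each term [W ^+ l] and [U ^+ l] cancel, leaving the scalar orthogonality relation in [l]. *)
Lemma rot_fourierK : rot_fourier * rot_fourier_inv = 1.
Proof.
rewrite block_opM -direct_sum_op1; apply: block_op_eq => a b.
transitivity ((M%:R^-1 * \sum_(l < M) (w ^+ b / w ^+ a) ^+ l) *: (1 : bop R J)).
  rewrite mulr_sumr scaler_suml; apply: eq_bigr => l _.
  rewrite bop_mulZl bop_mulZr scalerA expr_mul_eq1// -cc expr_div_n -!exprM; congr (_ *: _).
  by ring.
rewrite (sum_prim_root_ratio _ _ wM) eq_sym; case: ifP => _.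
  by rewrite mulVf// scale1r.
by rewrite mulr0 scale0r.
Qed.

(** Here the operator factor [U ^+ l * W ^+ m] comes out of the sum over [a]; orthogonality kills it
    unless l = m, when it equals 1. *)
Lemma rot_fourier_invK : rot_fourier_inv * rot_fourier = 1.
Proof.
rewrite block_opM -direct_sum_op1; apply: block_op_eq => l m.
transitivity ((M%:R^-1 * \sum_(a < M) (w ^+ l / w ^+ m) ^+ a) *: (U ^+ l * W ^+ m)).
  rewrite mulr_sumr scaler_suml; apply: eq_bigr => a _.
  rewrite bop_mulZl bop_mulZr scalerA -cc expr_div_n -!exprM; congr (_ *: _).
  by rewrite ![(a * _)%N]mulnC; ring.
rewrite (sum_prim_root_ratio _ _ wM); case: eqVneq => [->|_].
  by rewrite mulVf// scale1r expr_mul_eq1.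
by rewrite mulr0 scale0r.
Qed.

Lemma rot_fourier_unitary : unitary rot_fourier.
Proof.
rewrite /unitary (is_adjoint_adj rot_fourier_adjoint).
by rewrite rot_fourierK rot_fourier_invK.
Qed.

Variable tau : 'I_M -> 'I_M -> bop R J.
Hypothesis tauS : forall k l, U * tau k l * W = tau (ordS k) (ordS l).

Definition fourier_block (k : 'I_M) : bop R J :=
  M%:R^-1 *: \sum_(l < M) w ^+ (k * l) *: (tau 0 l * U ^+ l).

Lemma val_iter_ordS m (k : 'I_M) : iter m (@ordS M) k = ((k + m) %% M)%N :> nat.
Proof.
elim: m => [|m IH]; first by rewrite addn0 modn_small.
by rewrite /= IH -addn1 modnDml addn1 addnS.
Qed.

Lemma tau_conj m k l :
  U ^+ m * tau k l * W ^+ m = tau (iter m (@ordS M) k) (iter m (@ordS M) l).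
Proof.
elim: m => [|m IH]; first by rewrite mul1r mulr1.
by rewrite /= -tauS -IH exprS exprSr !mulrA.
Qed.

(** Covariance iterated [k] times from the entry (0, l - k) shifts both indices by [k] modulo
    [M]. *)
Lemma tau_toeplitz k l : tau k l = U ^+ k * tau 0 (l - k) * W ^+ k.
Proof.
rewrite tau_conj; congr tau; apply: ord_inj; rewrite val_iter_ordS.
  by rewrite add0n modn_small.
by rewrite -[RHS]/(val ((l - k) + k)) subrK.
Qed.

Lemma rot_fourier_intertwines :
  rot_fourier * block_op (fun k l => M%:R^-1 *: tau k l) =
  direct_sum_op fourier_block * rot_fourier.
Proof.
rewrite direct_sum_opM block_opM; apply: block_op_eq => a l.
(* The summation index is replaced by [l - m], so that [m] becomes the offset of the Toeplitz entry
   and matches the index in [fourier_block]. *)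
rewrite [LHS](reindex_inj (can_inj (subKr l)))/=.
rewrite /fourier_block /rot_fourier_entry bop_mulZl bop_mulZr scalerA.
rewrite mulr_suml scaler_sumr; apply: eq_bigr => m _.
rewrite !bop_mulZl !bop_mulZr !scalerA (tau_toeplitz (l - m)) subKr.
(* The left factors cancel, and the remaining [W ^+ (l - m)] equals [U ^+ m * W ^+ l] by
   [expr_ordB]. *)
have -> : W ^+ (l - m)%R * (U ^+ (l - m)%R * tau 0 m * W ^+ (l - m)%R) =
    tau 0 m * U ^+ m * W ^+ l.
  by rewrite !mulrA expr_mul_eq1// mul1r (expr_ordB _ _ WM UWE) mulrA.
have wa : (w ^+ (a * (l - m)%R))^-1 = w ^+ (a * m) * (w ^+ (a * l))^-1.
  have waM : (w ^+ a) ^+ M = 1 by rewrite -exprM mulnC exprM (prim_expr_order wM) expr1n.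
  rewrite !exprM (expr_ordB (y := (w ^+ a)^-1) _ _ waM) ?mulVf ?expf_neq0//.
  by rewrite invfM exprVn invrK.
by rewrite wa; congr (_ *: _); ring.
Qed.

Lemma rot_fourier_diagonalizes :
  direct_sum_op fourier_block =
  rot_fourier * block_op (fun k l => M%:R^-1 *: tau k l) * rot_fourier_inv.
Proof. by rewrite rot_fourier_intertwines -mulrA rot_fourierK mulr1. Qed.

(** After exchanging sums, the sum of w^(kl) over k is M for l = 0 and 0 otherwise; the surviving
    term carries [U ^+ 0 = 1]. *)
Lemma sum_fourier_block : \sum_k fourier_block k = tau 0 0.
Proof.
rewrite /fourier_block -scaler_sumr exchange_big/= scaler_sumr.
have E (l : 'I_M) : M%:R^-1 *: \sum_(k < M) w ^+ (k * l) *: (tau 0 l * U ^+ l) =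
    if l == 0 then tau 0 0 else 0.
  rewrite -scaler_suml scalerA.
  rewrite (eq_bigr (fun k : 'I_M => (w ^+ l / w ^+ (0%R : 'I_M)) ^+ k)); last first.
    by move=> k _; rewrite expr0 divr1 -exprM mulnC.
  rewrite (sum_prim_root_ratio _ _ wM); case: eqVneq => [->|_].
    by rewrite mulVf// scale1r mulr1.
  by rewrite mulr0 scale0r.
by under eq_bigr do rewrite E; rewrite -big_mkcond big_pred1_eq.
Qed.

End RotatedFourier.

(** * Powers of the phase-space rotation *)

Section Rotation.
Context {R : realType}.

Lemma exp_diagM (I : choiceType) (a b : I -> R) :
  exp_diag a * exp_diag b = exp_diag (fun i => a i + b i).
Proof.
by apply: bop_ext => x; apply: l2_ext => i; rewrite bopM !exp_diagE expiD mulrA.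
Qed.

Lemma exp_diagX (I : choiceType) (a : I -> R) m :
  exp_diag a ^+ m = exp_diag (fun i => a i * m%:R).
Proof.
elim: m => [|m IH].
  by apply: bop_ext => x; apply: l2_ext => i; rewrite exp_diagE mulr0 expi0 mul1r.
rewrite exprSr IH exp_diagM; congr exp_diag; apply/funext => i.
by rewrite -natr1 mulrDr mulr1.
Qed.

Lemma exp_diag1 (I : choiceType) (a : I -> R) :
  (forall i, expi (a i) = 1) -> exp_diag a = 1.
Proof.
by move=> a1; apply: bop_ext => x; apply: l2_ext => i; rewrite exp_diagE a1 mul1r.
Qed.

(** The number operator has integer eigenvalues, so M rotations by 2 pi / M multiply every Fock
    vector by a power of exp(-2 pi i) = 1. *)
Lemma rotationX_order (cutoff : option nat) M : (0 < M)%N ->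
  rotation cutoff (2 * pi / M%:R : R) ^+ M = 1.
Proof.
move=> M0; rewrite exp_diagX; apply: exp_diag1 => i.
by rewrite -expiX expiN -expiX exprVn -exprM mulnC exprM
  (prim_expr_order (expi_primitive_root M0)) expr1n invr1.
Qed.

End Rotation.

Theorem theorem2 (R : realType) (cutoff : option nat) (M : nat) (M_gt0 : (0 < M)%N)
    (tau : 'I_M -> 'I_M -> bop R (fock_level cutoff)) :
  let theta : R := 2 * pi / M%:R in
  let omega : R[i] := expi theta in
  let U : bop R (fock_level cutoff) := rotation cutoff theta in
  let zero : 'I_M := Ordinal M_gt0 in
  let tauAB : bop R ('I_M * fock_level cutoff)%type :=
    (M%:R : R[i])^-1 *: \sum_(k < M) \sum_(l < M) tensor_op (ketbra k l) (tau k l) in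
  let E (k : 'I_M) : bop R (fock_level cutoff) :=
    (M%:R : R[i])^-1 *: \sum_(l < M) omega ^+ (k * l) *: (tau zero l * U ^+ l) in
  (forall k l : 'I_M, U * tau k l * adj U = tau (ordS k) (ordS l)) ->
  [/\ unitarily_equivalent tauAB (direct_sum_op E),
      \sum_(k < M) E k = tau zero zero
    & psd tauAB <-> (forall k : 'I_M, psd (E k))].
Proof.
(* Writing M as [n.+1] gives ['I_M] its cyclic group structure, with zero and subtraction. *)
case: M M_gt0 tau => [//|n] M_gt0 tau theta omega U zero tauAB E.
have UW : is_adjoint U (exp_diag _) := exp_diag_adjoint _.
rewrite (is_adjoint_adj UW); set W := exp_diag _ in UW * => tauS.
have WU : is_adjoint W U.
  have := exp_diag_adjoint (fun i : fock_level cutoff => - - (theta * (val i)%:R)).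
  rewrite -/W; congr (is_adjoint _ _); congr exp_diag.
  by apply/funext => i; rewrite opprK.
have UWE : U * W = 1 by rewrite exp_diagM; apply: exp_diag1 => i; rewrite subrr expi0.
have WUE : W * U = 1 by rewrite exp_diagM; apply: exp_diag1 => i; rewrite addNr expi0.
have UM : U ^+ n.+1 = 1 by exact: rotationX_order.
have WM : W ^+ n.+1 = 1.
  (* [U] and [W] commute, so W^M = W^M U^M = (W U)^M = 1. *)
  by rewrite -[LHS]mulr1 -UM -exprMn_comm ?WUE ?expr1n// /GRing.comm WUE.
have wM : n.+1.-primitive_root omega := expi_primitive_root M_gt0.
have zeroE : zero = 0 by exact: val_inj.
have EE k : E k = fourier_block omega U tau k by rewrite /E zeroE.
have tauABE : tauAB = block_op (fun k l => (n.+1%:R : R[i])^-1 *: tau k l).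
  by rewrite /tauAB sum_tensor_ketbra block_opZ.
have DE : direct_sum_op E = rot_fourier n omega W * tauAB * rot_fourier_inv n omega U.
  rewrite tauABE -rot_fourier_diagonalizes//.
  by congr direct_sum_op; apply/funext => k.
have VV : is_adjoint (rot_fourier n omega W) (rot_fourier_inv n omega U).
  exact: rot_fourier_adjoint (conj_expi _) WU.
split.
- exists (rot_fourier n omega W); last by rewrite (is_adjoint_adj VV).
  exact: rot_fourier_unitary (conj_expi _) WU _ _.
- by rewrite zeroE (eq_bigr _ (fun k _ => EE k)) sum_fourier_block.
- rewrite -psd_direct_sum DE; apply: iff_sym; apply: psd_unitary_conj => //.
  exact: rot_fourier_invK.
Qed.
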